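(* Let $n$ be the number of training examples, $k$ the number of (continuous) features, $T$ the number of candidate thresholds per feature ($1\le T\le n$), and $d$ the depth budget. Including a one-time presort of all features, the total runtime of CLARITree (as specified in the context) is $$\mathcal{O}\left(kn\log n + d^2\, n\, k^4\, T\right).$$
   Context: Runtime counts elementary arithmetic operations and comparisons on real numbers. Data and leaf objective. The data are $D=\{(\bm x_i,y_i)\}_{i=1}^n$, $\bm x_i\in\mathbb R^k$, $y_i\in\mathbb R$. For $\mathcal I\subseteq\{1,\dots,n\}$ write $D_{\mathcal I}$ for the subset of data with index in $\mathcal I$. Fix $\lambda>0$ (leaf penalty) and $\kappa>0$ (ridge parameter). Define $$\mathrm{LeafObj}(D_{\mathcal I})=\min_{\beta_0\in\mathbb R,\ \boldsymbol\beta\in\mathbb R^k}\ \sum_{i\in\mathcal I}(y_i-\beta_0-\bm x_i^\top\boldsymbol\beta)^2+\kappa\|\boldsymbol\beta\|_2^2 .$$ Each feature $f$ has a finite candidate threshold pool $\mathcal P_f$ with at most $T$ elements. A candidate split of a node $D_{\mathcal I}$ is a pair $(f,\tau)$, $\tau\in\mathcal P_f$, for which both children $D_{f\le\tau}$ and $D_{f>\tau}$ (samples whose $f$-th coordinate is $\le\tau$, resp. $>\tau$) are nonempty; thresholds inducing the same partition of the node are the same split. Greedy CholeskyTree with depth budget $d$ on $D$: if $d=0$ (or there is no candidate split) return a leaf with objective $\lambda+\mathrm{LeafObj}(D)$. Otherwise choose the candidate split $(f^*,\tau^* )$ minimizing $2\lambda+\mathrm{LeafObj}(D_{f\le\tau})+\mathrm{LeafObj}(D_{f>\tau})$,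 recursively run Greedy CholeskyTree with budget $d-1$ on both children, and return the resulting tree if the sum of the two returned objectives is smaller than $\lambda+\mathrm{LeafObj}(D)$, and the leaf otherwise. CLARITree with depth budget $d$ on $D$: if $d=0$ (or there is no candidate split) return the leaf. Otherwise, for every candidate split $(f,\tau)$ run Greedy CholeskyTree with budget $d-1$ on both children, and choose the split $(f^*,\tau^* )$ minimizing the sum of the two returned objectives; then recursively run CLARITree with budget $d-1$ on $D_{f^*\le\tau^*}$ and $D_{f^*>\tau^*}$, and return the resulting tree if the sum of the two returned objectives is smaller than $\lambda+\mathrm{LeafObj}(D)$, and the leaf otherwise. Implementation of split enumeration (used in both procedures). All features are sorted once globally; node-wise sorted index lists are obtained by stable filtering of the parent's lists. For each node one stores the Cholesky factor $\mathbf L$ of the regularized Gram matrix $\mathbf A$ of the node, the vector $\bm b=\mathbf X^\top\bm y$, and $\|\bm y\|^2$. For each feature one sweeps through the node's samples in sorted order, moving one sample at a time from the right child to the left child; each move updates $\bm b$ and $\|\bm y\|^2$ of both children additively and the Cholesky factors of both children by a rank-one update/downdate ($\mathbf A\mapsto\mathbf A\pm\bm x\bm x^\top$), which costs $\mathcal O(k^2)$; the leaf objective of a child is evaluated as $\|\bm y\|^2-\|\mathbf L^{-1}\bm b\|^2$ in $\mathcal O(k^2)$ time. *)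

(* Defs.v *)
From HB Require Import structures.
From mathcomp Require Import all_boot all_order all_algebra.
From mathcomp Require Import reals.
From mathcomp Require Import ring lra.

Set Implicit Arguments.
Unset Strict Implicit.
Unset Printing Implicit Defensive.

Import Order.TTheory GRing.Theory Num.Theory.
Local Open Scope ring_scope.

(* A computation is a pair (number of real-number operations, result).  Only
   the primitives addM ... ltM below are charged, one unit each; copying data
   and handling sample and feature indices is free. *)
Definition comp (A : Type) : Type := (nat * A)%type.
Definition cost (A : Type) (m : comp A) : nat := m.1.
Definition result (A : Type) (m : comp A) : A := m.2.
Definition ret (A : Type) (a : A) : comp A := (0%N, a).
Definition tick (A : Type) (a : A) : comp A := (1%N, a).
Definition bind (A B : Type) (m : comp A) (f : A -> comp B) : comp B :=
  ((cost m + cost (f (result m)))%N, result (f (result m))).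

Notation "'let*' x ':=' m 'in' e" := (bind m (fun x => e))
  (at level 200, x name, m at level 200, e at level 200, right associativity).
Notation "'let*' ' x ':=' m 'in' e" := (bind m (fun x => e))
  (at level 200, x strict pattern, m at level 200, e at level 200,
   right associativity, only parsing).

Section Combinators.
Variables A B C : Type.

Fixpoint mapM (f : A -> comp B) (s : seq A) : comp (seq B) :=
  if s is a :: s' then
    let* b := f a in let* r := mapM f s' in ret (b :: r)
  else ret [::].

Fixpoint zipM (f : A -> B -> comp C) (s : seq A) (t : seq B) : comp (seq C) :=
  match s, t with
  | a :: s', b :: t' =>
      let* c := f a b in let* r := zipM f s' t' in ret (c :: r)
  | _, _ => ret [::]
  end.

Fixpoint foldM (f : B -> A -> comp B) (b : B) (s : seq A) : comp B :=
  if s is a :: s' then let* b' := f b a in foldM f b' s' else ret b.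

Fixpoint partitionM (p : A -> comp bool) (s : seq A) : comp (seq A * seq A) :=
  if s is a :: s' then
    let* b := p a in
    let* r := partitionM p s' in
    ret (if b then (a :: r.1, r.2) else (r.1, a :: r.2))
  else ret ([::], [::]).

Fixpoint mergeM (le : A -> A -> comp bool) (s : seq A) : seq A -> comp (seq A) :=
  fix merge_s (t : seq A) : comp (seq A) :=
  match s, t with
  | [::], _ => ret t
  | _, [::] => ret s
  | a :: s', b :: t' =>
      let* c := le a b in
      if c then let* r := mergeM le s' t in ret (a :: r)
      else let* r := merge_s t' in ret (b :: r)
  end.

Fixpoint msort_rec (fuel : nat) (le : A -> A -> comp bool) (s : seq A) :
    comp (seq A) :=
  if fuel is fuel'.+1 then
    if (size s <= 1)%N then ret s else
    let* s1 := msort_rec fuel' le (take (size s)./2 s) in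
    let* s2 := msort_rec fuel' le (drop (size s)./2 s) in
    mergeM le s1 s2
  else ret s.

(* Merge sort; the length of the list is more than enough fuel. *)
Definition msortM (le : A -> A -> comp bool) (s : seq A) : comp (seq A) :=
  msort_rec (size s) le s.

End Combinators.

Section Primitives.
Variable R : realType.

Definition addM (a b : R) : comp R := tick (a + b).
Definition subM (a b : R) : comp R := tick (a - b).
Definition mulM (a b : R) : comp R := tick (a * b).
Definition divM (a b : R) : comp R := tick (a / b).
Definition sqrtM (a : R) : comp R := tick (Num.sqrt a).
Definition leM (a b : R) : comp bool := tick (a <= b).
Definition ltM (a b : R) : comp bool := tick (a < b).

(* First pair with minimal first component among best :: s. *)
Definition argminM (A : Type) (best : R * A) (s : seq (R * A)) : comp (R * A) :=
  foldM (fun b c => let* lt := ltM c.1 b.1 in ret (if lt then c else b)) best s.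

End Primitives.

(* A lower triangular matrix of order m is the list of its m columns, the j-th
   one (from 0) listing the m - j entries from the diagonal downwards. *)
Section Cholesky.
Variable R : realType.

Definition pmM (down : bool) : R -> R -> comp R :=
  if down then @subM R else @addM R.

(* Factor of A + x x^T (down = false) or A - x x^T (down = true) from the
   factor L of A, by one Givens or hyperbolic rotation per column. *)
Fixpoint rank1M (down : bool) (L : seq (seq R)) (x : seq R) :
    comp (seq (seq R)) :=
  match L, x with
  | (l :: c) :: L', x0 :: x' =>
      let* ll := mulM l l in
      let* xx := mulM x0 x0 in
      let* rr := pmM down ll xx in
      let* r := sqrtM rr in
      let* c' := zipM (fun ci xi =>
        let* u := mulM l ci in let* v := mulM x0 xi in
        let* w := pmM down u v in divM w r) c x' in
      let* x'' := zipM (fun ci xi =>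
        let* u := mulM l xi in let* v := mulM x0 ci in
        let* w := subM u v in divM w r) c x' in
      let* L'' := rank1M down L' x'' in
      ret ((r :: c') :: L'')
  | _, _ => ret L
  end.

(* Forward substitution: L^-1 b. *)
Fixpoint solveM (L : seq (seq R)) (b : seq R) : comp (seq R) :=
  match L, b with
  | (l :: c) :: L', b0 :: b' =>
      let* z := divM b0 l in
      let* b'' := zipM (fun ci bi => let* u := mulM ci z in subM bi u) c b' in
      let* zs := solveM L' b'' in
      ret (z :: zs)
  | _, _ => ret [::]
  end.

Definition sqnormM (z : seq R) : comp R :=
  foldM (fun a u => let* uu := mulM u u in addM a uu) 0 z.

(* Sufficient statistics of a node.  With X~ the design matrix of the node,
   whose first column is the constant 1 of the unpenalized intercept, chol is
   the Cholesky factor of X~^T X~ + kappa diag(0, 1, ..., 1). *)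
Record stats := Stats { chol : seq (seq R); xty : seq R; yty : R }.

Definition leafobjM (st : stats) : comp R :=
  let* z := solveM (chol st) (xty st) in
  let* q := sqnormM z in
  subM (yty st) q.

End Cholesky.

Inductive tree (R : Type) (k : nat) : Type :=
  | Leaf : tree R k
  | Branch : 'I_k -> R -> tree R k -> tree R k -> tree R k.
Arguments Leaf {R k}.

Section Trees.
Variables (R : realType) (n k : nat).
(* Row i of X is x_i, and P f is the candidate threshold pool of feature f. *)
Variables (X : 'M[R]_(n, k)) (y : 'cV[R]_n) (P : 'I_k -> seq R).
Variables (lambda kappa : R).

Definition extended (i : 'I_n) : seq R := 1 :: [seq X i f | f <- enum 'I_k].

Definition empty_statsM : comp (stats R) :=
  let* s := sqrtM kappa in
  ret (Stats ((0 :: nseq k 0) :: [seq s :: nseq (k - j.+1) 0 | j <- iota 0 k])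
             (nseq k.+1 0) 0).

Definition moveM (down : bool) (st : stats R) (i : 'I_n) : comp (stats R) :=
  let* L := rank1M down (chol st) (extended i) in
  let* b := zipM (fun bi xi => let* u := mulM xi (y i 0) in pmM down bi u)
                 (xty st) (extended i) in
  let* yy := mulM (y i 0) (y i 0) in
  let* q := pmM down (yty st) yy in
  ret (Stats L b q).

(* An entry (i, t) of the sorted list of feature f is a sample i together with
   the smallest threshold t >= X i f of the pool P f, if there is one. *)
Definition entry : Type := ('I_n * option R)%type.

Record node := Node {
  sorted_lists : seq ('I_k * seq entry);
  node_stats : stats R }.

Fixpoint attachM (f : 'I_k) (s : seq 'I_n) : seq R -> comp (seq entry) :=
  fix attach_s (p : seq R) : comp (seq entry) :=
  match s, p with
  | [::], _ => ret [::]
  | i :: s', [::] =>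
      let* r := attachM f s' [::] in ret ((i, None) :: r)
  | i :: s', t :: p' =>
      let* c := leM (X i f) t in
      if c then let* r := attachM f s' p in ret ((i, Some t) :: r)
      else attach_s p'
  end.

Definition presort_featureM (f : 'I_k) : comp ('I_k * seq entry) :=
  let* s := msortM (fun i j => leM (X i f) (X j f)) (enum 'I_n) in
  let* p := msortM (@leM R) (P f) in
  let* l := attachM f s p in
  ret (f, l).

Definition rootM : comp node :=
  let* ls := mapM presort_featureM (enum 'I_k) in
  let* st0 := empty_statsM in
  let* st := foldM (moveM false) st0 (enum 'I_n) in
  ret (Node ls st).

Record split := Split {
  feature : 'I_k; threshold : R;
  left_stats : stats R; right_stats : stats R }.

(* Moves the samples of s one at a time from the right child to the left one;
   the last sample stays, so that both children are nonempty.  After sample i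
   has moved and while j is the next one, the current partition is induced by
   some threshold of the pool iff t < X j f, with t the threshold attached to
   i; hence each partition is listed once. *)
Fixpoint sweepM (f : 'I_k) (l r : stats R) (s : seq entry) : comp (seq split) :=
  match s with
  | (i, t) :: (((j, _) :: _) as s') =>
      let* l' := moveM false l i in
      let* r' := moveM true r i in
      match t with
      | Some tau =>
          let* c := ltM tau (X j f) in
          let* rest := sweepM f l' r' s' in
          ret (if c then Split f tau l' r' :: rest else rest)
      | None => sweepM f l' r' s'
      end
  | _ => ret [::]
  end.

Definition splitsM (nd : node) : comp (seq split) :=
  let* l0 := empty_statsM in
  let* ss := mapM (fun fs => sweepM fs.1 l0 (node_stats nd) fs.2)
                  (sorted_lists nd) in
  ret (flatten ss).

Definition childrenM (nd : node) (sp : split) : comp (node * node) :=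
  let* parts := mapM (fun fs =>
      let* lr := partitionM
        (fun e : entry => leM (X e.1 (feature sp)) (threshold sp)) fs.2 in
      ret ((fs.1, lr.1), (fs.1, lr.2))) (sorted_lists nd) in
  ret (Node (unzip1 parts) (left_stats sp), Node (unzip2 parts) (right_stats sp)).

Definition greedy_scoreM (sp : split) : comp R :=
  let* a := leafobjM (left_stats sp) in
  let* b := leafobjM (right_stats sp) in
  let* ll := addM lambda lambda in
  let* u := addM ll a in
  addM u b.

(* The result of both procedures is the objective paired with the tree. *)
Definition outcome : Type := (R * tree R k)%type.

Definition leafM (nd : node) : comp outcome :=
  let* o := leafobjM (node_stats nd) in
  let* v := addM lambda o in
  ret (v, Leaf).

Definition tree_or_leafM (lf : outcome) (sp : split) (tl tr : outcome) :
    comp outcome :=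
  let* v := addM tl.1 tr.1 in
  let* c := ltM v lf.1 in
  ret (if c then (v, Branch (feature sp) (threshold sp) tl.2 tr.2) else lf).

Fixpoint greedyM (d : nat) (nd : node) : comp outcome :=
  let* lf := leafM nd in
  if d is d'.+1 then
    let* sps := splitsM nd in
    let* scored := mapM (fun sp =>
      let* v := greedy_scoreM sp in ret (v, sp)) sps in
    if scored is c0 :: cs then
      let* best := argminM c0 cs in
      let* ch := childrenM nd best.2 in
      let* tl := greedyM d' ch.1 in
      let* tr := greedyM d' ch.2 in
      tree_or_leafM lf best.2 tl tr
    else ret lf
  else ret lf.

Definition lookahead_scoreM (d : nat) (nd : node) (sp : split) : comp R :=
  let* ch := childrenM nd sp in
  let* gl := greedyM d ch.1 in
  let* gr := greedyM d ch.2 in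
  addM gl.1 gr.1.

Fixpoint clariM (d : nat) (nd : node) : comp outcome :=
  let* lf := leafM nd in
  if d is d'.+1 then
    let* sps := splitsM nd in
    let* scored := mapM (fun sp =>
      let* v := lookahead_scoreM d' nd sp in ret (v, sp)) sps in
    if scored is c0 :: cs then
      let* best := argminM c0 cs in
      let* ch := childrenM nd best.2 in
      let* tl := clariM d' ch.1 in
      let* tr := clariM d' ch.2 in
      tree_or_leafM lf best.2 tl tr
    else ret lf
  else ret lf.

Definition CLARITree (d : nat) : comp outcome :=
  let* nd := rootM in clariM d nd.

End Trees.

(* The implementation evaluates the ridge objective of a node: if the
   statistics of a node describe the nonempty sample set I, then leafobjM
   computes the minimum of the penalized squared loss over I. *)
Section LeafObjective.
Variables (R : realType) (n k : nat).
Variables (X : 'M[R]_(n, k)) (y : 'cV[R]_n) (kappa : R).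

Definition leaf_loss (I : {set 'I_n}) (b0 : R) (b : 'cV[R]_k) : R :=
  \sum_(i in I) (y i 0 - b0 - (row i X *m b) 0 0) ^+ 2
  + kappa * \sum_j b j 0 ^+ 2.

Definition is_LeafObj (I : {set 'I_n}) (v : R) : Prop :=
  (exists b0 b, leaf_loss I b0 b = v) /\ (forall b0 b, v <= leaf_loss I b0 b).

Fixpoint dot (u v : seq R) : R :=
  match u, v with a :: u', b :: v' => a * b + dot u' v' | _, _ => 0 end.

Fixpoint wf_factor (m : nat) (L : seq (seq R)) : bool :=
  match m, L with
  | 0%N, [::] => true
  | m'.+1, c :: L' => (size c == m'.+1) && wf_factor m' L'
  | _, _ => false
  end.

(* |L^T v|^2 *)
Fixpoint quad (L : seq (seq R)) (v : seq R) : R :=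
  match L, v with
  | c :: L', _ :: v' => dot c v ^+ 2 + quad L' v'
  | _, _ => 0
  end.

Definition posdef (m : nat) (q : seq R -> R) : Prop :=
  forall v, size v = m -> v <> nseq m 0 -> 0 < q v.

Definition gram (I : {set 'I_n}) (v : seq R) : R :=
  \sum_(i in I) dot (extended X i) v ^+ 2 + kappa * dot (behead v) (behead v).

Record describes (st : stats R) (I : {set 'I_n}) : Prop := Describes {
  d_wf : wf_factor k.+1 (chol st);
  d_size : size (xty st) = k.+1;
  d_chol : forall v, size v = k.+1 -> quad (chol st) v = gram I v;
  d_xty : forall v, size v = k.+1 ->
    dot (xty st) v = \sum_(i in I) y i 0 * dot (extended X i) v;
  d_yty : yty st = \sum_(i in I) y i 0 ^+ 2 }.

Lemma dot0v m v : dot (nseq m 0) v = 0.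
Proof.
by elim: m v => [|m IH] [|a v] //=; rewrite mul0r add0r IH.
Qed.

Lemma dotv0 u m : dot u (nseq m 0) = 0.
Proof.
by elim: u m => [|a u IH] [|m] //=; rewrite mulr0 add0r IH.
Qed.

Lemma dotvv_ge0 v : 0 <= dot v v.
Proof. by elim: v => //= a v IH; rewrite addr_ge0 // -expr2 sqr_ge0. Qed.

Lemma dotvv_eq0 v : dot v v = 0 -> v = nseq (size v) 0.
Proof.
elim: v => //= a v IH /eqP.
rewrite paddr_eq0 -?expr2 ?sqr_ge0 ?dotvv_ge0 //.
by rewrite sqrf_eq0 => /andP[/eqP-> /eqP/IH {1}->].
Qed.

Lemma quad0 L m : quad L (nseq m 0) = 0.
Proof.
elim: L m => [|c L IH] [|m] //=.
by rewrite IH -[0 :: nseq m 0]/(nseq m.+1 0) dotv0 expr0n addr0.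
Qed.

Lemma zip_rot (down : bool) (l x0 r : R) c x v :
  size c = size x ->
  dot (result (zipM (fun ci xi =>
        let* u := mulM l ci in let* v := mulM x0 xi in
        let* w := pmM down u v in divM w r) c x)) v
  = (l * dot c v + (-1) ^+ down * (x0 * dot x v)) / r.
Proof.
elim: c x v => [|a c IH] [|b x] [|w v] //= => [_|_|_|[/IH e]];
  rewrite ?mulr0 ?addr0 ?mul0r //.
rewrite /result /= in e *; rewrite e.
by case: down {IH e} => /=; rewrite ?expr1 ?expr0 ?mul1r ?mulN1r; ring.
Qed.

Lemma zip_rotx (l x0 r : R) c x v :
  size c = size x ->
  dot (result (zipM (fun ci xi =>
        let* u := mulM l xi in let* v := mulM x0 ci in
        let* w := subM u v in divM w r) c x)) v
  = (l * dot x v - x0 * dot c v) / r.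
Proof.
elim: c x v => [|a c IH] [|b x] [|w v] //= => [_|_|_|[/IH e]];
  rewrite ?mulr0 ?subr0 ?mul0r //.
rewrite /result /= in e *; rewrite e; ring.
Qed.

Lemma size_zipM A B C (f : A -> B -> comp C) s t :
  size s = size t -> size (result (zipM f s t)) = size s.
Proof. by elim: s t => [|a s IH] [|b t] //= [/IH] /= ->. Qed.

Lemma rank1P (down : bool) m L x :
  wf_factor m L -> size x = m ->
  posdef m (fun v => quad L v + (-1) ^+ down * dot x v ^+ 2) ->
  wf_factor m (result (rank1M down L x)) /\
  forall v, size v = m ->
    quad (result (rank1M down L x)) v
    = quad L v + (-1) ^+ down * dot x v ^+ 2.
Proof.
elim: m L x => [|m IH] [|[|l c] L] [|x0 x] //=.
  by move=> _ _ _; split=> // -[|//] _; rewrite expr0n mulr0 addr0.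
rewrite eqSS => /andP[/eqP sc wL] [sx] pd.
set e := (-1) ^+ down in pd *.
have ee : e * e = 1 by rewrite /e; case: (down); rewrite ?expr0 ?expr1; ring.
set rr := l * l + e * (x0 * x0).
have rr0 : 0 < rr.
  have := pd (1 :: nseq m 0); rewrite /= size_nseq => /(_ erefl).
  rewrite !dotv0 quad0 !mulr1 !addr0 !expr2; apply.
  by case=> /eqP; rewrite oner_eq0.
have Err : result (pmM down (l * l) (x0 * x0)) = rr.
  by rewrite /rr /e; case: (down); rewrite /= ?expr0 ?expr1; ring.
set r := Num.sqrt rr.
have r0 : r != 0 by rewrite gt_eqF // sqrtr_gt0.
have rrE : r ^+ 2 = rr by rewrite sqr_sqrtr // ltW.
set c' := result (zipM (fun ci xi =>
        let* u := mulM l ci in let* v := mulM x0 xi in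
        let* w := pmM down u v in divM w r) c x).
set x' := result (zipM (fun ci xi =>
        let* u := mulM l xi in let* v := mulM x0 ci in
        let* w := subM u v in divM w r) c x).
have szcx : size c = size x by rewrite sc sx.
have sc' : size c' = m by rewrite size_zipM.
have sx' : size x' = m by rewrite size_zipM.
have rot v0 v :
  (l * v0 + dot c v) ^+ 2 + e * (x0 * v0 + dot x v) ^+ 2
  = (r * v0 + dot c' v) ^+ 2 + e * dot x' v ^+ 2.
  rewrite zip_rot // zip_rotx // -/e.
  set p := dot c v; set q := dot x v.
  have -> : (r * v0 + (l * p + e * (x0 * q)) / r) ^+ 2
          = r ^+ 2 * v0 ^+ 2 + (l * p + e * (x0 * q)) * v0 *+ 2
            + (l * p + e * (x0 * q)) ^+ 2 / r ^+ 2 by field.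
  have -> : e * ((l * q - x0 * p) / r) ^+ 2
          = e * (l * q - x0 * p) ^+ 2 / r ^+ 2 by field.
  rewrite -addrA -mulrDl rrE.
  have -> : (l * p + e * (x0 * q)) ^+ 2 + e * (l * q - x0 * p) ^+ 2
          = rr * (p ^+ 2 + e * q ^+ 2).
    by rewrite /rr /e; case: (down); rewrite ?expr0 ?expr1; ring.
  rewrite [rr * _]mulrC mulfK ?gt_eqF //.
  have -> : rr * v0 ^+ 2 + (l * p + e * (x0 * q)) * v0 *+ 2
            + (p ^+ 2 + e * q ^+ 2)
          = (l * v0 + p) ^+ 2 + e * (x0 * v0 + q) ^+ 2 by rewrite /rr; ring.
  by [].
have pd' : posdef m (fun v => quad L v + e * dot x' v ^+ 2).
  move=> v sv vn0.
  have := pd (- (dot c' v / r) :: v); rewrite /= sv => /(_ erefl).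
  have e0 : r * - (dot c' v / r) + dot c' v = 0 by field.
  rewrite addrAC rot e0 expr0n add0r addrC; apply.
  by case.
have [wL' qL'] := IH L x' wL sx' pd'.
rewrite Err -/r -/c' -/x'.
split=> [|[|v0 v] // [sv]]; first by rewrite sc' eqxx.
by rewrite /= qL' // [in RHS]addrAC rot addrA addrAC.
Qed.

Lemma zip_sub (z : R) c b v :
  size c = size b ->
  dot (result (zipM (fun ci bi => let* u := mulM ci z in subM bi u) c b)) v
  = dot b v - z * dot c v.
Proof.
elim: c b v => [|a c IH] [|b0 b] [|w v] //= => [_|_|_|[/IH e]];
  rewrite ?mulr0 ?subr0 //.
rewrite /result /= in e *; rewrite e; ring.
Qed.

Lemma sqnormE (z : seq R) : result (sqnormM z) = dot z z.
Proof.
rewrite /sqnormM -[RHS]add0r.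
elim: z 0 => [|a z IH] s /=; first by rewrite addr0.
by rewrite IH /= addrA.
Qed.

(* Completing the square with z = L^-1 b. *)
Lemma solveP m L b :
  wf_factor m L -> size b = m -> posdef m (quad L) ->
  let z := result (solveM L b) in
  (forall v, size v = m -> 0 <= quad L v - dot b v *+ 2 + dot z z) /\
  (exists2 v, size v = m & quad L v - dot b v *+ 2 + dot z z = 0).
Proof.
elim: m L b => [|m IH] [|[|l c] L] [|b0 b] //=.
  by move=> _ _ _; split=> [v _|]; [|exists [::]] => //=; rewrite mul0rn subr0 addr0.
rewrite eqSS => /andP[/eqP sc wL] [sb] pd.
have l0 : l != 0.
  have := pd (1 :: nseq m 0); rewrite /= size_nseq => /(_ erefl).
  rewrite dotv0 quad0 mulr1 !addr0 lt0r sqrf_eq0 => h.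
  suff /h/andP[]: 1 :: nseq m 0 <> 0 :: nseq m 0 :> seq R by [].
  by case=> /eqP; rewrite oner_eq0.
have pd' : posdef m (quad L).
  move=> v sv vn0; have := pd (- (dot c v / l) :: v); rewrite /= sv => /(_ erefl).
  have -> : l * - (dot c v / l) + dot c v = 0 by field.
  by rewrite expr0n add0r; apply; case.
set b' := result (zipM _ c b).
have scb : size c = size b by rewrite sc sb.
have sb' : size b' = m by rewrite size_zipM.
set z := b0 / l.
have Eb v : dot b v = dot b' v + z * dot c v by rewrite zip_sub // subrK.
have Eb0 : b0 = l * z by rewrite mulrC divfK.
have key v0 v : (l * v0 + dot c v) ^+ 2 + quad L v - (b0 * v0 + dot b v) *+ 2
    + (z * z + dot (result (solveM L b')) (result (solveM L b')))
  = (l * v0 + dot c v - z) ^+ 2 + (quad L v - dot b' v *+ 2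
    + dot (result (solveM L b')) (result (solveM L b'))).
  by rewrite Eb {1}Eb0; ring.
have [h1 [w sw h2]] := IH L b' wL sb' pd'.
split=> [[|v0 v] // [sv]|].
  by rewrite key addr_ge0 ?sqr_ge0 ?h1.
exists ((z - dot c w) / l :: w); first by rewrite /= sw.
by rewrite key h2 addr0 mulrC divfK // subrK subrr expr0n.
Qed.

Definition coefs (b0 : R) (b : 'cV[R]_k) : seq R :=
  b0 :: [seq b j 0 | j <- enum 'I_k].

Lemma size_extended i : size (extended X i) = k.+1.
Proof. by rewrite /= size_map size_enum_ord. Qed.

Lemma dot_map (I : Type) (f g : I -> R) (s : seq I) :
  dot [seq f j | j <- s] [seq g j | j <- s] = \sum_(j <- s) f j * g j.
Proof.
by elim: s => [|j s IH] /=; rewrite ?big_nil // big_cons IH.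
Qed.

Lemma dot_coefs i b0 b :
  dot (extended X i) (coefs b0 b) = b0 + (row i X *m b) 0 0.
Proof.
rewrite /= mul1r dot_map big_enum mxE /=; congr (_ + _).
by apply: eq_bigr => j _; rewrite mxE.
Qed.

Lemma coefsP v : size v = k.+1 -> exists b0 b, v = coefs b0 b.
Proof.
case: v => // b0 v [sv]; exists b0, (\col_j nth 0 v j); congr (_ :: _).
rewrite -[LHS](mkseq_nth 0) sv /mkseq -val_enum_ord -map_comp.
by apply: eq_map => j /=; rewrite mxE.
Qed.

Lemma leaf_lossE st I b0 b : describes st I ->
  leaf_loss I b0 b = quad (chol st) (coefs b0 b)
    - dot (xty st) (coefs b0 b) *+ 2 + yty st.
Proof.
case=> _ _ dq db ->.
have sv : size (coefs b0 b) = k.+1 by rewrite /= size_map size_enum_ord.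
rewrite dq // db // /leaf_loss /gram.
have -> : dot (behead (coefs b0 b)) (behead (coefs b0 b)) = \sum_j b j 0 ^+ 2.
  by rewrite dot_map big_enum; apply: eq_bigr => j _; rewrite expr2.
have -> : \sum_(i in I) (y i 0 - b0 - (row i X *m b) 0 0) ^+ 2
  = \sum_(i in I) dot (extended X i) (coefs b0 b) ^+ 2
    - (\sum_(i in I) y i 0 * dot (extended X i) (coefs b0 b)) *+ 2
    + \sum_(i in I) y i 0 ^+ 2.
  rewrite -sumrMnl -sumrB -big_split; apply: eq_bigr => i _.
  rewrite dot_coefs /=; ring.
ring.
Qed.

Hypothesis kappa_gt0 : 0 < kappa.

Lemma gram_posdef I : I != set0 -> posdef k.+1 (gram I).
Proof.
move=> /set0Pn[i iI] [|b0 v] // [sv] vn0.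
have s0 : 0 <= \sum_(i in I) dot (extended X i) (b0 :: v) ^+ 2.
  by apply: sumr_ge0 => j _; rewrite sqr_ge0.
have p0 : 0 <= kappa * dot v v by rewrite mulr_ge0 ?dotvv_ge0 // ltW.
rewrite lt_neqAle /gram addr_ge0 // andbT eq_sym; apply/negP.
rewrite paddr_eq0 // mulf_eq0 (gt_eqF kappa_gt0) orFb => /andP[sq0 /eqP/dotvv_eq0 ve0].
have ve : v = nseq (size v) 0 by [].
move: sq0; rewrite psumr_eq0 => [|j _]; last exact: sqr_ge0.
move=> /allP/(_ i (mem_index_enum _)) /implyP/(_ iI).
rewrite sqrf_eq0 /= ve dotv0 mul1r addr0 => /eqP b00.
by apply: vn0; rewrite b00 ve sv.
Qed.

Lemma leafobjP st I : I != set0 -> describes st I ->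
  is_LeafObj I (result (leafobjM st)).
Proof.
move=> In0 dst; have [wL sb dq _ _] := dst.
have pd : posdef k.+1 (quad (chol st)).
  by move=> v sv vn0; rewrite dq // gram_posdef.
have -> : result (leafobjM st) = yty st
    - dot (result (solveM (chol st) (xty st))) (result (solveM (chol st) (xty st))).
  by rewrite -sqnormE.
have [ge [v sv eq0]] := solveP wL sb pd.
split=> [|b0 b].
  have [b0 [b vE]] := coefsP sv; exists b0, b.
  rewrite (leaf_lossE _ _ dst) -vE -[LHS]subr0 -[X in _ - X]eq0; ring.
have sc : size (coefs b0 b) = k.+1 by rewrite /= size_map size_enum_ord.
rewrite (leaf_lossE _ _ dst) lerBlDr -addrA [yty st + _]addrC addrA.
by rewrite lerDr ge.
Qed.

Lemma describes_empty : describes (result (empty_statsM k kappa)) set0.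
Proof.
have tailP m v s : size v = m -> s ^+ 2 = kappa ->
  wf_factor m [seq s :: nseq (m - j.+1) 0 | j <- iota 0 m] /\
  quad [seq s :: nseq (m - j.+1) 0 | j <- iota 0 m] v = kappa * dot v v.
  elim: m v => [|m IH] [|a v] //=; rewrite ?mulr0 // => -[sv] sE.
  have [w q] := IH v sv sE.
  have E : [seq s :: nseq (m.+1 - j.+1) 0 | j <- iota 1 m]
         = [seq s :: nseq (m - j.+1) 0 | j <- iota 0 m].
    by rewrite -[1%N]/(1 + 0)%N iotaDl -map_comp; apply: eq_map.
  rewrite E w q subSS subn0 size_nseq eqxx dot0v addr0 exprMn sE; split=> //; ring.
have sE : Num.sqrt kappa ^+ 2 = kappa by rewrite sqr_sqrtr // ltW.
split=> //=.
- by rewrite !size_nseq eqxx; case: (tailP k (nseq k 0) _ (size_nseq _ _) sE).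
- by rewrite size_nseq.
- move=> [|a v] // [sv]; have [_ ->] := tailP k v _ sv sE.
  by rewrite /gram big_set0 mul0r dot0v addr0 expr0n.
- by move=> v _; rewrite big_set0; exact: (dot0v k.+1 v).
- by rewrite big_set0.
Qed.

Lemma zip_pm (down : bool) (a : R) b x v :
  size b = size x ->
  dot (result (zipM (fun bi xi => let* u := mulM xi a in pmM down bi u) b x)) v
  = dot b v + (-1) ^+ down * (a * dot x v).
Proof.
elim: b x v => [|c b IH] [|x0 x] [|w v] //= => [_|_|_|[/IH e]];
  rewrite ?mulr0 ?addr0 //.
rewrite /result /= in e *; rewrite e.
by case: down {IH e} => /=; rewrite ?expr1 ?expr0 ?mul1r ?mulN1r; ring.
Qed.

Lemma describes_move (down : bool) st i (I J : {set 'I_n}) :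
  describes st I ->
  (if down then i \in I /\ J = I :\ i else i \notin I /\ J = i |: I) ->
  J != set0 ->
  describes (result (moveM X y down st i)) J.
Proof.
move=> [wL sb dq db dy] HJ J0.
have sumJ (F : 'I_n -> R) :
    \sum_(j in J) F j = \sum_(j in I) F j + (-1) ^+ down * F i.
  case: down HJ => -[iI ->] /=; last by rewrite big_setU1 // addrC mul1r.
  by rewrite expr1 mulN1r (big_setD1 i iI) /= [F i + _]addrC addrK.
have gJ v : gram J v = gram I v + (-1) ^+ down * dot (extended X i) v ^+ 2.
  by rewrite /gram sumJ addrAC.
have [|v sv vn0|wL' qL'] := @rank1P down k.+1 (chol st) (extended X i) wL.
- exact: size_extended.
- by rewrite dq // -gJ gram_posdef.
have sbx : size (xty st) = size (extended X i) by rewrite sb size_extended.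
split; rewrite /result /moveM /= -/(result _).
- exact: wL'.
- by have /= := size_zipM (fun bi xi => let* u := mulM xi (y i 0) in pmM down bi u) sbx; rewrite sb.
- by move=> v sv; rewrite gJ -dq // -qL'.
- move=> v sv; rewrite sumJ -db //.
  exact: zip_pm.
- rewrite sumJ -dy; case: (down) => /=; rewrite ?expr1 ?expr0; ring.
Qed.

End LeafObjective.

(* Main.v *)
(* Moving a sample or evaluating a leaf objective costs O(k^2), so sweeping a
   node with m samples costs O(m k^3).  Both children of a split are nonempty
   and partition the samples of the node, so all the nodes of one level together
   hold at most n samples, and no level has more nodes than samples: the O(k^2)
   spent at a leaf is therefore O(k^2) per sample.  Hence greedy induction with
   depth d costs O(d m k^3).  A node of CLARITree tries at most k T splits
   (distinct listed splits have distinct thresholds), which makes O(d m k^4 T)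
   per node and, summed over d levels, O(d^2 n k^4 T).  Merge sort accounts for
   the k n log n. *)
Require Import Defs.
From mathcomp Require Import all_boot all_order all_algebra.
From mathcomp Require Import reals exp.
From mathcomp Require Import zify lra.

Set Implicit Arguments.
Unset Strict Implicit.
Unset Printing Implicit Defensive.

Import Order.TTheory GRing.Theory Num.Theory.
Local Open Scope ring_scope.

(** * Costs and results of the monadic combinators *)

Section CombinatorCosts.
Local Open Scope nat_scope.
Variables A B C : Type.

Lemma cost_bind (m : Defs.comp A) (f : A -> Defs.comp B) :
  cost (bind m f) = cost m + cost (f (result m)).
Proof. by []. Qed.

Lemma result_bind (m : Defs.comp A) (f : A -> Defs.comp B) :
  result (bind m f) = result (f (result m)).
Proof. by []. Qed.

Lemma cost_ret (a : A) : cost (ret a) = 0. Proof. by []. Qed.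

Lemma result_ret (a : A) : result (ret a) = a. Proof. by []. Qed.

(** [p] is later instantiated with the invariants of lists and splits, which make a uniform bound
    [c] available. *)
Lemma cost_mapM (f : A -> Defs.comp B) (p : pred A) c s :
  (forall a, p a -> cost (f a) <= c) -> all p s ->
  cost (mapM f s) <= c * size s.
Proof.
move=> cf; elim: s => [|a s IH] //= /andP[pa /IH] cs.
by rewrite -/(cost _) addn0 mulnS leq_add //; exact: cf.
Qed.

Lemma result_mapM (f : A -> Defs.comp B) s :
  result (mapM f s) = [seq result (f a) | a <- s].
Proof. by elim: s => //= a s ->. Qed.

Lemma cost_zipM (f : A -> B -> Defs.comp C) c s t :
  (forall a b, cost (f a b) <= c) -> cost (zipM f s t) <= c * size t.
Proof.
move=> cf; elim: s t => [|a s IH] [|b t] //=.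
by rewrite -/(cost _) addn0 mulnS leq_add.
Qed.

Lemma size_zipM_le (f : A -> B -> Defs.comp C) s t :
  size (result (zipM f s t)) <= size t.
Proof. by elim: s t => [|a s IH] [|b t] //=; rewrite ltnS; exact: IH. Qed.

Lemma cost_foldM (f : B -> A -> Defs.comp B) c b s :
  (forall b a, cost (f b a) <= c) -> cost (foldM f b s) <= c * size s.
Proof.
move=> cf; elim: s b => [|a s IH] b //=.
by rewrite -/(cost _) mulnS leq_add.
Qed.

Lemma foldM_ind (Q : B -> Prop) (f : B -> A -> Defs.comp B) b s :
  (forall b a, Q b -> Q (result (f b a))) -> Q b -> Q (result (foldM f b s)).
Proof. by move=> Qf; elim: s b => [|a s IH] b //= Qb; apply/IH/Qf. Qed.

Lemma partitionM_tick (p : pred A) (q : A -> Defs.comp bool) s :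
  (forall a, q a = tick (p a)) ->
  partitionM q s = (size s, ([seq a <- s | p a], [seq a <- s | ~~ p a])).
Proof.
by move=> qE; elim: s => //= a s ->; rewrite qE /bind /=; case: (p a);
  rewrite addn0.
Qed.

End CombinatorCosts.

(** * Merge sort: comparison count and correctness *)

Section MergeSort.
Local Open Scope nat_scope.
Variables (A : eqType) (r : rel A) (le : A -> A -> Defs.comp bool).
Hypothesis leE : forall a b, le a b = tick (r a b).

Lemma mergeM_nil s : mergeM le s [::] = ret s.
Proof. by case: s. Qed.

Lemma mergeM_cons a s b t : mergeM le (a :: s) (b :: t) =
  bind (le a b) (fun c =>
    if c then bind (mergeM le s (b :: t)) (fun u => ret (a :: u))
    else bind (mergeM le (a :: s) t) (fun u => ret (b :: u))).
Proof. by []. Qed.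

Lemma cost_mergeM s t : cost (mergeM le s t) <= size s + size t.
Proof.
elim: s t => [|a s IHs] t; first by case: t.
elim: t => [|b t IHt]; first by rewrite mergeM_nil.
rewrite mergeM_cons cost_bind leE [cost (tick _)]/=.
case: ifP => _; rewrite cost_bind cost_ret.
  by have /= := IHs (b :: t); lia.
by move: IHt => /=; lia.
Qed.

Lemma mergeM_merge s t : result (mergeM le s t) = merge r s t.
Proof.
elim: s t => [|a s IHs] t; first by case: t.
elim: t => [|b t IHt]; first by rewrite mergeM_nil.
rewrite mergeM_cons result_bind leE /=.
case: ifP => _; rewrite result_bind result_ret ?IHs //.
by rewrite IHt.
Qed.

Lemma msort_recS fuel s : msort_rec fuel.+1 le s =
  if size s <= 1 then ret s else
  bind (msort_rec fuel le (take (size s)./2 s)) (fun s1 =>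
  bind (msort_rec fuel le (drop (size s)./2 s)) (fun s2 => mergeM le s1 s2)).
Proof. by []. Qed.

Lemma perm_msort_rec fuel s : perm_eq (result (msort_rec fuel le s)) s.
Proof.
elim: fuel s => [|fuel IH] s //; rewrite msort_recS.
case: ifP => _ //; rewrite !result_bind mergeM_merge perm_merge.
by rewrite -[X in perm_eq _ X](cat_take_drop (size s)./2) perm_cat.
Qed.

(** [p] bounds the number of halvings: both halves of a list of length at most [2 ^ p.+1] have
    length at most [2 ^ p], and each level merges at a total cost of at most [size s]. Exhausted
    fuel costs nothing, so the fuel does not enter the bound. *)
Lemma cost_msort_rec fuel p s :
  size s <= 2 ^ p -> cost (msort_rec fuel le s) <= p * size s.
Proof.
elim: fuel p s => [|fuel IH] p s // sp; rewrite msort_recS.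
case: (leqP (size s) 1) => [|s1] //; case: p sp => [|p] sp.
  by move: sp; rewrite leqNgt s1.
rewrite expnS in sp.
have cut : size (take (size s)./2 s) + size (drop (size s)./2 s) = size s.
  by rewrite -size_cat cat_take_drop.
have sz1 : size (take (size s)./2 s) = (size s)./2.
  by rewrite size_take; case: ltnP => //; lia.
rewrite !cost_bind.
have c1 := IH p (take (size s)./2 s) ltac:(lia).
have c2 := IH p (drop (size s)./2 s) ltac:(lia).
have := cost_mergeM (result (msort_rec fuel le (take (size s)./2 s)))
                    (result (msort_rec fuel le (drop (size s)./2 s))).
rewrite (perm_size (perm_msort_rec _ _)) (perm_size (perm_msort_rec _ _)) cut.
by move: c1 c2; rewrite mulSn -[in p * size s]cut mulnDr; lia.
Qed.

Lemma cost_msortM s : cost (msortM le s) <= up_log 2 (size s) * size s.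
Proof. by apply: cost_msort_rec; apply: up_logP. Qed.

Lemma perm_msortM s : perm_eq (result (msortM le s)) s.
Proof. exact: perm_msort_rec. Qed.

Lemma sorted_msortM s : total r -> sorted r (result (msortM le s)).
Proof.
move=> tot; rewrite /msortM.
(* Sortedness needs enough fuel: the induction keeps [size s <= fuel], which survives because both
   halves are strictly shorter. *)
move: {2 3}(size s) (leqnn (size s)) => fuel.
elim: fuel s => [|fuel IH] s; first by case: s.
move=> sf; rewrite msort_recS; case: ifP => [|/negbT].
  by case: s {sf} => [|a []].
rewrite -ltnNge => s1; rewrite !result_bind mergeM_merge.
by apply: merge_sorted => //; apply: IH; rewrite ?size_take_min ?size_drop; lia.
Qed.

End MergeSort.

(** * Rank-one updates, forward substitution and leaf objectives *)

Section LinearAlgebraCosts.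
Local Open Scope nat_scope.
Variable R : realType.

Lemma cost_pmM down (a b : R) : cost (pmM down a b) = 1.
Proof. by case: down. Qed.

(** A column costs four scalar operations and two passes of four operations per remaining entry. The
    length of [x] controls every pass, since [zipM] stops at the shorter list. *)
Lemma cost_rank1M down (L : seq (seq R)) x :
  cost (rank1M down L x) <= 8 * size x ^ 2.
Proof.
elim: L x => [|[|l c] L IH] [|x0 x] //=; rewrite -!/(cost _) cost_pmM !addn0.
set r := Num.sqrt _.
set f := fun ci xi : R => _; set g := fun ci xi : R => _.
have cf : cost (zipM f c x) <= 4 * size x.
  by apply: cost_zipM => a b; rewrite /f /= -!/(cost _) cost_pmM.
have cg : cost (zipM g c x) <= 4 * size x by apply: cost_zipM.
have := IH (result (zipM g c x)).
have : size (result (zipM g c x)) <= size x by exact: size_zipM_le.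
by move: (cost (rank1M _ _ _)) (size (result _)) cf cg => u v; nia.
Qed.

Lemma cost_solveM (L : seq (seq R)) b : cost (solveM L b) <= size b ^ 2.
Proof.
elim: L b => [|[|l c] L IH] [|b0 b] //=; rewrite -!/(cost _) !addn0.
set f := fun ci bi : R => _.
have cf : cost (zipM f c b) <= 2 * size b by apply: cost_zipM.
have := IH (result (zipM f c b)).
have : size (result (zipM f c b)) <= size b by exact: size_zipM_le.
by move: (cost (solveM _ _)) (size (result _)) cf => u v; nia.
Qed.

Lemma size_solveM (L : seq (seq R)) b : size (result (solveM L b)) <= size b.
Proof.
elim: L b => [|[|l c] L IH] [|b0 b] //=; rewrite ltnS.
by apply: leq_trans (IH _) _; exact: size_zipM_le.
Qed.

(** With [b] the length of [xty st], substitution costs at most [b ^ 2], the squared norm [2 * b]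
    and the subtraction 1, which add up to a square. *)
Lemma cost_leafobjM (st : stats R) : cost (leafobjM st) <= (size (xty st)).+1 ^ 2.
Proof.
rewrite /leafobjM !cost_bind [cost (subM _ _)]/=.
have c1 := cost_solveM (chol st) (xty st).
have c2 : cost (sqnormM (result (solveM (chol st) (xty st)))) <=
    2 * size (result (solveM (chol st) (xty st))) by apply: cost_foldM.
have := size_solveM (chol st) (xty st); nia.
Qed.

End LinearAlgebraCosts.

(** * Invariants of nodes and splits *)

Section TreeCosts.
Local Open Scope nat_scope.
Variables (R : realType) (n k T : nat).
Variables (X : 'M[R]_(n, k)) (y : 'cV[R]_n) (P : 'I_k -> seq R).
Variables (lambda kappa : R).
Hypothesis k_gt0 : 0 < k.
Hypothesis P_le : forall f, size (P f) <= T.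

Lemma cost_moveM down (st : stats R) i : cost (moveM X y down st i) <= 48 * k ^ 2.
Proof.
rewrite /moveM !cost_bind cost_ret.
set f := fun bi xi : R => _.
have c1 := cost_rank1M down (chol st) (extended X i).
have c2 : cost (zipM f (xty st) (extended X i)) <= 2 * size (extended X i).
  by apply: cost_zipM => a b; rewrite /f cost_bind cost_pmM.
have -> : cost (mulM (y i ord0) (y i ord0)) = 1 by [].
(* The sum [8 * k.+1 ^ 2 + 2 * k.+1 + 2] is at most [48 * k ^ 2] because [k] is positive. *)
rewrite cost_pmM; move: c1 c2; rewrite size_extended; nia.
Qed.

Lemma size_xty_moveM down (st : stats R) i :
  size (xty (result (moveM X y down st i))) <= k.+1.
Proof. by rewrite -(size_extended X i); exact: size_zipM_le. Qed.

Definition entry_ok (f : 'I_k) (e : entry R n) : bool :=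
  if e.2 is Some t then (X e.1 f <= t)%R && (t \in P f) else true.

Definition list_ok (s : seq 'I_n) (fl : 'I_k * seq (entry R n)) : bool :=
  [&& perm_eq (unzip1 fl.2) s,
      sorted (fun e e' : entry R n => X e.1 fl.1 <= X e'.1 fl.1)%R fl.2
    & all (entry_ok fl.1) fl.2].

(** [s] is a ghost list of the samples of the node. Of the statistics only the length of [xty] is
    tracked, as the cost of a leaf objective is bounded through it. *)
Definition node_ok (s : seq 'I_n) (nd : node R n k) : bool :=
  [&& size (sorted_lists nd) == k, all (list_ok s) (sorted_lists nd)
    & size (xty (node_stats nd)) <= k.+1].

(** A witness on each side of the threshold makes both children nonempty, so that constant costs per
    node can be charged to samples. *)
Definition split_ok (s : seq 'I_n) (sp : Defs.split R k) : bool :=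
  [&& has (fun i => X i (feature sp) <= threshold sp)%R s,
      has (fun i => threshold sp < X i (feature sp))%R s,
      size (xty (left_stats sp)) <= k.+1 & size (xty (right_stats sp)) <= k.+1].

(** * The sweep over one feature *)

Lemma sweepM_cons f l r i t j u e : sweepM X y f l r ((i, t) :: (j, u) :: e) =
  bind (moveM X y false l i) (fun l' => bind (moveM X y true r i) (fun r' =>
    match t with
    | Some tau => bind (ltM tau (X j f)) (fun c =>
        bind (sweepM X y f l' r' ((j, u) :: e)) (fun rest =>
          ret (if c then Defs.Split f tau l' r' :: rest else rest)))
    | None => sweepM X y f l' r' ((j, u) :: e)
    end)).
Proof. by []. Qed.

(** Each sample accounts for two moves at [48 * k ^ 2] and at most one comparison. *)
Lemma cost_sweepM f l r e : cost (sweepM X y f l r e) <= 97 * k ^ 2 * size e.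
Proof.
elim: e l r => [|[i t] [|[j u] e] IH] l r //.
rewrite sweepM_cons !cost_bind.
set l' := result (moveM X y false l i).
set r' := result (moveM X y true r i).
have := cost_moveM false l i; have := cost_moveM true r i; have := IH l' r'.
case: t => [tau|]; rewrite ?cost_bind ?cost_ret ?[cost (ltM _ _)]/=;
  move: (cost (sweepM _ _ _ _ _ _));
  by rewrite [size [:: _, _ & _]]/= [size (_ :: _)]/=; nia.
Qed.

Lemma size_sweepM f l r e : size (result (sweepM X y f l r e)) <= size e.
Proof.
elim: e l r => [|[i t] [|[j u] e] IH] l r //.
rewrite sweepM_cons !result_bind.
set l' := result (moveM X y false l i).
set r' := result (moveM X y true r i).
have := IH l' r'; case: t => [tau|]; last by move/leq_trans; apply.
rewrite !result_bind result_ret; case: ifP => _ //= h.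
by apply: leq_trans h _.
Qed.

(** The sample just moved is on the left because its attached threshold bounds it; the test
    [tau < X j f] puts the next one on the right. As [e] shrinks while [s] stays fixed, only an
    inclusion is assumed. *)
Lemma sweepM_split_ok s f l r e : {subset unzip1 e <= s} ->
  sorted (fun e e' : entry R n => X e.1 f <= X e'.1 f)%R e ->
  all (entry_ok f) e ->
  all (split_ok s) (result (sweepM X y f l r e)).
Proof.
elim: e l r => [|[i t] [|[j u] e] IH] l r //.
rewrite sweepM_cons !result_bind.
set l' := result (moveM X y false l i).
set r' := result (moveM X y true r i).
move=> es /andP[_ so] /andP[/= ok ok'].
have {}IH : all (split_ok s) (result (sweepM X y f l' r' ((j, u) :: e))).
  by apply: IH => // a ha; apply: es; rewrite inE ha orbT.
case: t es ok => [tau|] es // /andP[it _].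
rewrite !result_bind result_ret; case: ifP => [tj|] //=.
rewrite IH andbT; apply/and4P; split; try exact: size_xty_moveM.
  by apply/hasP; exists i => //; apply: es; rewrite inE eqxx.
by apply/hasP; exists j => //; apply: es; rewrite !inE eqxx orbT.
Qed.

(* The listed thresholds increase strictly: the sweep lists [tau] only when the
   samples still to the right exceed it. *)
Lemma sweepM_thresholds f l r e :
  sorted (fun e e' : entry R n => X e.1 f <= X e'.1 f)%R e ->
  all (entry_ok f) e ->
  let ts := [seq threshold sp | sp <- result (sweepM X y f l r e)] in
  [/\ pairwise <%R ts, {subset ts <= P f}
    & forall i t e', e = (i, t) :: e' -> all (>= X i f)%R ts].
Proof.
elim: e l r => [|[i t] [|[j u] e] IH] l r //.
rewrite sweepM_cons !result_bind.
set l' := result (moveM X y false l i).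
set r' := result (moveM X y true r i).
move=> /andP[/= ij so] /andP[ok ok'].
have [pw sb] := IH l' r' so ok'.
(* The third clause strengthens the induction: all later thresholds are at least [X j f], which
   exceeds [tau] whenever [tau] is listed. *)
move=> /(_ _ _ _ erefl) aj {IH}.
have ai : all (>= X i f)%R
    [seq threshold sp | sp <- result (sweepM X y f l' r' ((j, u) :: e))].
  by apply: sub_all aj => a; exact: le_trans.
case: t ok => [tau|] /=; last by move=> _; split=> // i0 t0 e0 [<-].
move=> /andP[itau tauP]; case: ifP => /= tj; last by split=> // i0 t0 e0 [<-].
split.
- rewrite pw andbT; apply: sub_all aj => a; exact: lt_le_trans.
- by move=> a; rewrite inE => /predU1P[->|/sb].
- by move=> i0 t0 e0 [<- _ _]; rewrite itau.
Qed.

(** Strictly increasing thresholds are distinct, and they come from the pool; this is how [T] enters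
    the bound. *)
Lemma size_sweepM_pool f l r e :
  sorted (fun e e' : entry R n => X e.1 f <= X e'.1 f)%R e ->
  all (entry_ok f) e -> size (result (sweepM X y f l r e)) <= T.
Proof.
move=> so ok; have [pw sb _] := sweepM_thresholds l r so ok.
rewrite -(size_map (@threshold _ _)); apply: leq_trans (P_le f).
by apply: uniq_leq_size sb; apply: pairwise_uniq pw; exact: ltxx.
Qed.

(** * Candidate splits and children of a node *)

Section FlattenMap.
Variables (A B : Type) (f : A -> seq B).

Lemma all_flatten_map (p : pred A) (q : pred B) s :
  (forall a, p a -> all q (f a)) -> all p s -> all q (flatten [seq f a | a <- s]).
Proof.
by move=> pq; elim: s => //= a s IH /andP[/pq qa /IH]; rewrite all_cat qa.
Qed.

Lemma size_flatten_map (p : pred A) c s :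
  (forall a, p a -> size (f a) <= c) -> all p s ->
  size (flatten [seq f a | a <- s]) <= c * size s.
Proof.
move=> pc; elim: s => //= a s IH /andP[/pc ca /IH].
by rewrite size_cat mulnS; exact: leq_add.
Qed.

End FlattenMap.

Lemma list_ok_size s fl : list_ok s fl -> size fl.2 = size s.
Proof. by move=> /and3P[/perm_size]; rewrite size_map. Qed.

(** Splits are counted in two ways: the bound by [size s * k] keeps greedy scoring linear in the
    samples, and the bound by [T * k] limits the lookaheads of CLARITree. *)
Lemma splitsM_ok s nd : node_ok s nd ->
  let sps := splitsM X y kappa nd in
  [/\ cost sps <= 1 + 97 * k ^ 2 * size s * k, all (split_ok s) (result sps),
      size (result sps) <= size s * k & size (result sps) <= T * k].
Proof.
case/and3P=> /eqP sk ok _; rewrite /splitsM cost_bind !result_bind cost_bind.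
rewrite cost_ret result_ret addn0 result_mapM.
split.
- rewrite leq_add2l -[X in _ <= _ * X]sk.
  apply: (cost_mapM (p := list_ok s)) => // fl flok.
  by rewrite -(list_ok_size flok); exact: cost_sweepM.
- apply: all_flatten_map ok => fl /and3P[pe so ok].
  by apply: sweepM_split_ok so ok => i; rewrite (perm_mem pe).
- rewrite -[X in _ <= _ * X]sk; apply: size_flatten_map ok => fl flok.
  by rewrite -(list_ok_size flok); exact: size_sweepM.
- rewrite -[X in _ <= _ * X]sk; apply: size_flatten_map ok => fl /and3P[_ so ok].
  exact: size_sweepM_pool.
Qed.

Lemma list_ok_filter (p : pred 'I_n) s fl : list_ok s fl ->
  list_ok [seq i <- s | p i] (fl.1, [seq e <- fl.2 | p e.1]).
Proof.
case/and3P=> pe so ok; apply/and3P; split=> /=.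
- by rewrite /unzip1 -filter_map perm_filter.
- by apply: sorted_filter so => a b c; exact: le_trans.
- by rewrite all_filter; apply: sub_all ok => e oke; apply/implyP.
Qed.

(** All lists are filtered by the same predicate on samples, so they enumerate the same two parts
    [s1] and [s2]; stable filtering keeps them sorted. *)
Lemma childrenM_ok s nd sp : node_ok s nd -> split_ok s sp ->
  cost (childrenM X nd sp) <= size s * k /\
  exists s1 s2,
    [/\ node_ok s1 (result (childrenM X nd sp)).1,
        node_ok s2 (result (childrenM X nd sp)).2,
        0 < size s1, 0 < size s2 & size s1 + size s2 = size s].
Proof.
case/and3P=> /eqP sk ok _ /and4P[sl sr xl xr].
pose p i := (X i (feature sp) <= threshold sp)%R.
have partE (e : seq (entry R n)) : partitionM
    (fun e : entry R n => leM (X e.1 (feature sp)) (threshold sp)) e =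
    (size e, ([seq a <- e | p a.1], [seq a <- e | ~~ p a.1])).
  exact: partitionM_tick.
rewrite /childrenM; split.
  rewrite cost_bind cost_ret addn0 -[X in _ <= _ * X]sk.
  apply: (cost_mapM (p := list_ok s)) => // fl flok.
  by rewrite cost_bind partE cost_ret addn0 -(list_ok_size flok).
exists [seq i <- s | p i], [seq i <- s | ~~ p i].
rewrite result_bind result_ret result_mapM; split=> /=.
- apply/and3P; rewrite /= /unzip1 !size_map sk eqxx -map_comp; split=> //.
  rewrite all_map; apply: sub_all ok => fl flok /=.
  by have := list_ok_filter p flok; have := partE fl.2;
    case: partitionM => c q [_ ->].
- apply/and3P; rewrite /= /unzip2 !size_map sk eqxx -map_comp; split=> //.
  rewrite all_map; apply: sub_all ok => fl flok /=.
  by have := list_ok_filter (predC p) flok; have := partE fl.2;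
    case: partitionM => c q [_ ->].
- by rewrite size_filter -has_count.
- rewrite size_filter -has_count; apply: sub_has sr => i /=.
  by rewrite /p -ltNge.
- by rewrite !size_filter count_predC.
Qed.

(** * One recursion step, then induction on the depth *)

Lemma cost_argminM (A : Type) (c0 : R * A) cs : cost (argminM c0 cs) <= size cs.
Proof. by rewrite -[X in _ <= X]mul1n; apply: cost_foldM. Qed.

Lemma argminM_ok (A : Type) (p : pred A) (c0 : R * A) cs :
  all (fun c => p c.2) (c0 :: cs) -> p (result (argminM c0 cs)).2.
Proof.
elim: cs c0 => [|c cs IH] c0 /=; first by rewrite andbT.
move=> /and3P[p0 pc pcs]; apply: IH => /=.
by rewrite pcs andbT; case: ifP.
Qed.

Lemma cost_leafobjM_le (st : stats R) :
  size (xty st) <= k.+1 -> cost (leafobjM st) <= 9 * k ^ 2.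
Proof.
move=> sx; apply: leq_trans (cost_leafobjM st) _.
(* This compares bases: [k + 2 <= 3 * k]. *)
rewrite -[9]/(3 ^ 2) -expnMn leq_exp2r //; lia.
Qed.

Lemma cost_leafM s nd : node_ok s nd -> cost (leafM lambda nd) <= 10 * k ^ 2.
Proof.
case/and3P=> _ _ /cost_leafobjM_le c.
have k2 : 0 < k ^ 2 by rewrite expn_gt0 k_gt0.
have -> : cost (leafM lambda nd) = cost (leafobjM (node_stats nd)) + 1 by [].
lia.
Qed.

Lemma cost_greedy_scoreM s sp :
  split_ok s sp -> cost (greedy_scoreM lambda sp) <= 21 * k ^ 2.
Proof.
case/and4P=> _ _ /cost_leafobjM_le cl /cost_leafobjM_le cr.
have k2 : 0 < k ^ 2 by rewrite expn_gt0 k_gt0.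
have -> : cost (greedy_scoreM lambda sp) =
    cost (leafobjM (left_stats sp)) +
      (cost (leafobjM (right_stats sp)) + 3) by [].
lia.
Qed.

(* [greedyM] and [clariM] are both convertible to this form at positive depth. *)
Definition bestM (score : Defs.split R k -> Defs.comp R) (nd : node R n k)
    (rec : node R n k -> Defs.comp (outcome R k)) : Defs.comp (outcome R k) :=
  bind (leafM lambda nd) (fun lf =>
  bind (splitsM X y kappa nd) (fun sps =>
  bind (mapM (fun sp => bind (score sp) (fun v => ret (v, sp))) sps)
    (fun scored =>
  if scored is c0 :: cs then
    bind (argminM c0 cs) (fun best =>
    bind (childrenM X nd best.2) (fun ch =>
    bind (rec ch.1) (fun tl =>
    bind (rec ch.2) (fun tr =>
    tree_or_leafM lf best.2 tl tr))))
  else ret lf))).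

(** A step consists of overhead, at most [N] scores of cost [c], and two recursive calls. The calls
    cost [g] per sample and the children partition [s], so together they cost no more than
    [g * size s]. *)
Lemma cost_bestM score rec nd s N c g :
  node_ok s nd -> 0 < size s ->
  size (result (splitsM X y kappa nd)) <= N ->
  (forall sp, split_ok s sp -> cost (score sp) <= c) ->
  (forall s' nd', node_ok s' nd' -> 0 < size s' ->
    cost (rec nd') <= g * size s') ->
  cost (bestM score nd rec) <= 112 * k ^ 3 * size s + N * c + g * size s.
Proof.
move=> ok s0 sN cscore crec.
have [c2 oks sk _] := splitsM_ok ok.
have c1 := cost_leafM ok.
set sps := result (splitsM X y kappa nd) in oks sk sN *.
pose m := mapM (fun sp => bind (score sp) (fun v => ret (v, sp))) sps.
have -> : cost (bestM score nd rec) = cost (leafM lambda nd) +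
    (cost (splitsM X y kappa nd) + (cost m + cost (
    if result m is c0 :: cs then
      bind (argminM c0 cs) (fun best =>
      bind (childrenM X nd best.2) (fun ch =>
      bind (rec ch.1) (fun tl =>
      bind (rec ch.2) (fun tr =>
      tree_or_leafM (result (leafM lambda nd)) best.2 tl tr))))
    else ret (result (leafM lambda nd))))) by [].
have c3 : cost m <= N * c.
  apply: leq_trans (_ : c * size sps <= _); last by rewrite mulnC leq_mul.
  by apply: (cost_mapM (p := split_ok s)) => // sp /cscore;
    rewrite cost_bind addn0.
have okm : all (fun c : R * Defs.split R k => split_ok s c.2) (result m).
  by rewrite result_mapM all_map; apply: sub_all oks => sp.
have szm : size (result m) <= size s * k.
  by rewrite result_mapM size_map.
case: (result m) okm szm => [|c0 cs] okm szm; first by rewrite cost_ret; nia.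
rewrite [X in _ + (_ + (_ + X))](_ : _ =
  cost (argminM c0 cs) + (cost (childrenM X nd (result (argminM c0 cs)).2) +
    (cost (rec (result (childrenM X nd (result (argminM c0 cs)).2)).1) +
      (cost (rec (result (childrenM X nd (result (argminM c0 cs)).2)).2) + 2)))) //.
have c4 := cost_argminM c0 cs.
have [c5 [s1 [s2 [ok1 ok2 s10 s20 s12]]]] := childrenM_ok ok (argminM_ok okm).
have := crec _ _ ok1 s10; have := crec _ _ ok2 s20.
move: szm; rewrite [size (_ :: _)]/=.
have -> : g * size s = g * size s1 + g * size s2 by rewrite -mulnDr s12.
(* The summands are the leaf, the enumeration, the minimum, the children and the final choice; 112
   is the sum of the coefficients, as [k] and [size s] are positive. *)
have : 10 * k ^ 2 + (1 + 97 * k ^ 2 * size s * k) + size s * k + size s * k + 2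
  <= 112 * k ^ 3 * size s by nia.
lia.
Qed.

(** Every level adds [112 * k ^ 3] per sample of overhead and [k * (21 * k ^ 2)] per sample of
    scoring, hence 133. *)
Lemma cost_greedyM d s nd : node_ok s nd -> 0 < size s ->
  cost (greedyM X y lambda kappa d nd) <= 133 * d.+1 * k ^ 3 * size s.
Proof.
elim: d s nd => [|d IH] s nd ok s0.
  rewrite /= -/(cost _) addn0; apply: leq_trans (cost_leafM ok) _; nia.
have [_ _ sN _] := splitsM_ok ok.
have := cost_bestM ok s0 sN (@cost_greedy_scoreM s) IH.
move/leq_trans; apply; nia.
Qed.

(** The two greedy runs share the samples of the node, giving 133; building the children and adding
    the objectives account for the other 2. *)
Lemma cost_lookahead_scoreM d s nd sp : node_ok s nd -> split_ok s sp ->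
  cost (lookahead_scoreM X y lambda kappa d nd sp)
    <= 135 * d.+1 * k ^ 3 * size s.
Proof.
move=> ok oks; have [c [s1 [s2 [ok1 ok2 s10 s20 s12]]]] := childrenM_ok ok oks.
set ch := result _ in ok1 ok2.
have -> : cost (lookahead_scoreM X y lambda kappa d nd sp) =
    cost (childrenM X nd sp) + (cost (greedyM X y lambda kappa d ch.1) +
      (cost (greedyM X y lambda kappa d ch.2) + 1)) by [].
have := cost_greedyM d ok1 s10; have := cost_greedyM d ok2 s20.
have s0 : 0 < size s by rewrite -s12 addn_gt0 s10.
have kq : k <= d.+1 * k ^ 3 by nia.
have : size s * k + 1 <= 2 * (d.+1 * k ^ 3) * size s.
  by move: (d.+1 * _) kq => q kq; nia.
by move: c; rewrite -s12 -!mulnA; lia.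
Qed.

(** With [u = k ^ 4 * T * size s], passing from depth [d] to [d.+1] adds at most
    [(112 + 135 * d.+1) * u], below the increment [250 * (2 * d + 3) * u] of the claimed bound. The
    square arises because each level runs greedy searches whose cost is linear in the depth. *)
Lemma cost_clariM d s nd : 0 < T -> node_ok s nd -> 0 < size s ->
  cost (clariM X y lambda kappa d nd) <= 250 * d.+1 ^ 2 * k ^ 4 * T * size s.
Proof.
move=> T0; elim: d s nd => [|d IH] s nd ok s0.
  rewrite /= -/(cost _) addn0; apply: leq_trans (cost_leafM ok) _.
  have := leq_pexp2l k_gt0 (isT : 2 <= 4).
  have : k ^ 4 <= k ^ 4 * (T * size s) by rewrite leq_pmulr // muln_gt0 T0.
  by rewrite exp1n muln1 -!mulnA; lia.
have [_ _ _ sN] := splitsM_ok ok.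
have := cost_bestM ok s0 sN (fun sp => cost_lookahead_scoreM d (sp := sp) ok) IH.
move/leq_trans; apply.
have : T * k * (135 * d.+1 * k ^ 3 * size s) = 135 * d.+1 * (k ^ 4 * T * size s).
  by rewrite (expnS k 3); lia.
have : k ^ 3 * size s <= k ^ 4 * T * size s.
  rewrite leq_mul2r (leq_trans (leq_pexp2l k_gt0 (isT : 3 <= 4))) ?orbT //.
  exact: leq_pmulr.
have E e : 250 * e * k ^ 4 * T * size s = 250 * e * (k ^ 4 * T * size s) by lia.
rewrite !E -(mulnA 112).
by move: (k ^ 4 * T * size s) (k ^ 3 * size s) => u v uv ->; nia.
Qed.

(** * Presorting, the root node and the total cost *)

Lemma attachM_cons f i s t p : attachM X f (i :: s) (t :: p) =
  bind (leM (X i f) t) (fun c =>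
    if c then bind (attachM X f s (t :: p)) (fun r => ret ((i, Some t) :: r))
    else attachM X f (i :: s) p).
Proof. by []. Qed.

Lemma attachM_nil f i s : attachM X f (i :: s) [::] =
  bind (attachM X f s [::]) (fun r => ret ((i, None) :: r)).
Proof. by []. Qed.

(** As in a merge, every comparison consumes a sample or a threshold. *)
Lemma cost_attachM f s p : cost (attachM X f s p) <= size s + size p.
Proof.
elim: s p => [|i s IHs] p; first by case: p.
elim: p => [|t p IHp].
  by rewrite attachM_nil cost_bind cost_ret; have /= := IHs [::]; lia.
rewrite attachM_cons cost_bind [cost (leM _ _)]/=; case: ifP => _.
  by rewrite cost_bind cost_ret; have /= := IHs (t :: p); lia.
by move: IHp => /=; lia.
Qed.

Lemma attachM_ok f s p : {subset p <= P f} ->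
  unzip1 (result (attachM X f s p)) = s /\
  all (entry_ok f) (result (attachM X f s p)).
Proof.
elim: s p => [|i s IHs] p; first by case: p.
elim: p => [|t p IHp] sp.
  by rewrite attachM_nil result_bind result_ret /=; have [-> ->] := IHs [::] sp.
rewrite attachM_cons result_bind [result (leM _ _)]/=; case: ifP => it.
  rewrite result_bind result_ret /=; have [-> ->] := IHs (t :: p) sp.
  by rewrite andbT /entry_ok /= it sp ?mem_head.
by apply: IHp => a ap; apply: sp; rewrite inE ap orbT.
Qed.

(** The samples and the pool are both sorted, then merged in a linear pass; [T <= n] bounds the pool
    terms by the sample terms. *)
Lemma cost_presort_featureM f : T <= n ->
  cost (presort_featureM X P f) <= 2 * up_log 2 n * n + 2 * n.
Proof.
move=> Tn; rewrite /presort_featureM.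
set s := msortM _ (enum 'I_n); set p := msortM _ (P f).
have cs : cost s <= up_log 2 n * n.
  rewrite -[X in up_log 2 X]size_enum_ord -[X in _ <= _ * X]size_enum_ord.
  exact: (cost_msortM (r := fun i j => (X i f <= X j f)%R)).
have sP : size (P f) <= n by exact: leq_trans (P_le f) Tn.
have cp : cost p <= up_log 2 n * n.
  apply: leq_trans (cost_msortM (r := <=%R) _ _) _ => //.
  by rewrite leq_mul // leq_up_log.
rewrite [cost _](_ : _ =
  cost s + (cost p + (cost (attachM X f (result s) (result p)) + 0))) //.
have := cost_attachM f (result s) (result p).
rewrite (perm_size (perm_msortM (r := fun i j => (X i f <= X j f)%R) _ _)) //.
rewrite (perm_size (perm_msortM (r := <=%R) _ _)) // size_enum_ord.
move: (cost s) (cost p) (cost (attachM _ _ _ _)) cs cp => a b c.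
by rewrite -mulnA; move: (size _) sP (up_log _ _ * n) => u un w; lia.
Qed.

Lemma presort_featureM_ok f :
  list_ok (enum 'I_n) (result (presort_featureM X P f)).
Proof.
rewrite /presort_featureM 3!result_bind result_ret.
set s := msortM _ (enum 'I_n); set p := msortM _ (P f).
pose r (i j : 'I_n) := (X i f <= X j f)%R.
have pp : perm_eq (result p) (P f) by exact: (perm_msortM (r := <=%R)).
have [|us ok] := @attachM_ok f (result s) (result p).
  by move=> a; rewrite (perm_mem pp).
apply/and3P; split=> //=.
  by rewrite us; exact: (perm_msortM (r := r)).
rewrite -(sorted_map (e' := r)) -/(unzip1 _) us.
by apply: (sorted_msortM (r := r)) => // i j; exact: le_total.
Qed.

Lemma cost_rootM : T <= n -> cost (Defs.rootM X y P kappa) <=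
  2 * (k * n * up_log 2 n) + 2 * (k * n) + 48 * (k ^ 2 * n) + 1.
Proof.
move=> Tn; pose st0 := result (empty_statsM k kappa).
have -> : cost (Defs.rootM X y P kappa) =
    cost (mapM (presort_featureM X P) (enum 'I_k)) +
      (1 + (cost (foldM (moveM X y false) st0 (enum 'I_n)) + 0)) by [].
have c1 : cost (mapM (presort_featureM X P) (enum 'I_k)) <=
    (2 * up_log 2 n * n + 2 * n) * k.
  rewrite -[X in _ <= _ * X](size_enum_ord k).
  apply: (cost_mapM (p := predT)); last exact: all_predT.
  by move=> f _; exact: cost_presort_featureM.
have c2 : cost (foldM (moveM X y false) st0 (enum 'I_n)) <= 48 * k ^ 2 * n.
  rewrite -[X in _ <= _ * X]size_enum_ord; apply: cost_foldM => st i.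
  exact: cost_moveM.
move: (cost (mapM _ _)) (cost (foldM _ _ _)) c1 c2 => a b; lia.
Qed.

Lemma rootM_ok : node_ok (enum 'I_n) (result (Defs.rootM X y P kappa)).
Proof.
rewrite /Defs.rootM !result_bind result_ret result_mapM.
apply/and3P; split=> /=; first by rewrite size_map size_enum_ord.
  by rewrite all_map; apply/allP => f _; exact: presort_featureM_ok.
apply: (@foldM_ind _ _ (fun st : stats R => size (xty st) <= k.+1)) => [st i _|].
  exact: size_xty_moveM.
by rewrite /= size_nseq.
Qed.

Lemma cost_CLARITree d : 0 < d -> 0 < T <= n ->
  cost (CLARITree X y P lambda kappa d) <=
    2 * (k * n * up_log 2 n) + 1051 * (d ^ 2 * n * k ^ 4 * T).
Proof.
move=> d0 /andP[T0 Tn]; have n0 : 0 < n by exact: leq_trans Tn.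
rewrite /CLARITree cost_bind.
have c1 := cost_rootM Tn.
have := cost_clariM d T0 rootM_ok; rewrite size_enum_ord => /(_ n0) c2.
have k2 : k <= k ^ 2 by rewrite -{1}(expn1 k) leq_pexp2l.
have k4 : k ^ 2 <= k ^ 4 by rewrite leq_pexp2l.
have k0 : 0 < k ^ 4 by rewrite expn_gt0 k_gt0.
(* This uses [0 < d] and turns 250 into 1000; the root adds 2, 48 and 1 to give 1051. *)
have dd : d.+1 ^ 2 <= 4 * d ^ 2 by nia.
have kn : k ^ 4 * n <= d ^ 2 * n * k ^ 4 * T.
  have -> : d ^ 2 * n * k ^ 4 * T = k ^ 4 * n * (d ^ 2 * T) by lia.
  by rewrite leq_pmulr // muln_gt0 T0 expn_gt0 d0.
have c3 : 250 * d.+1 ^ 2 * k ^ 4 * T * n <= 1000 * (d ^ 2 * n * k ^ 4 * T).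
  have := leq_mul (leqnn (k ^ 4 * T * n)) dd; lia.
have : k * n <= k ^ 4 * n by rewrite leq_mul2r (leq_trans k2) ?orbT.
have : k ^ 2 * n <= k ^ 4 * n by rewrite leq_mul2r k4 orbT.
have : 1 <= k ^ 4 * n by rewrite muln_gt0 k0.
move: c1 c2 c3 kn; move: (k * n * up_log 2 n) (k * n) (k ^ 2 * n) (k ^ 4 * n).
move: (d ^ 2 * n * k ^ 4 * T) (250 * _ * _ * _ * _); lia.
Qed.

End TreeCosts.

(** * From binary to natural logarithms, and the final constant *)

Lemma up_log2_le_ln (R : realType) n : (0 < n)%N ->
  (up_log 2 n)%:R <= 2 * ln n%:R + 1 :> R.
Proof.
move=> n0; have ln2 : 2^-1 <= ln 2 :> R.
  (* The inequality [ln (1 + x) <= x] at minus one half bounds [ln 2] from below. *)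
  have := @le_ln1Dx R (- 2^-1); rewrite ltrN2 invf_lt1 ?ltr1n // => /(_ isT).
  have -> : 1 - 2^-1 = 2^-1 :> R by rewrite {1}(splitr 1) mul1r addrK.
  by rewrite lnV ?posrE ?ltr0n // lerN2.
have [n1|n1] := leqP n 1.
  by rewrite (_ : n = 1%N) ?up_log1 ?ln1 ?mulr0 ?add0r ?ler01 //; lia.
have /andP[+ _] := up_log_bounds (isT : (1 < 2)%N) n1.
have : (0 < up_log 2 n)%N by rewrite up_log_gt0.
(* Rounding up costs at most one: [2 ^ L <= n] for the predecessor [L], which explains the [+ 1]. *)
case: (up_log 2 n) => // L _ /= /ltnW Ln.
rewrite -natr1 lerD2r.
have : ln (2 ^+ L) <= ln n%:R :> R.
  by rewrite ler_ln ?posrE ?exprn_gt0 ?ltr0n // -natrX ler_nat.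
rewrite lnXn ?ltr0n // -[_ *+ L]mulr_natl => h.
rewrite -ler_pdivrMl ?ltr0n //; apply: (le_trans _ h).
by rewrite mulrC ler_wpM2l.
Qed.

Theorem theorem5p1 (R : realType) :
  exists C : R, 0 < C /\
  forall (n k T d : nat) (X : 'M[R]_(n, k)) (y : 'cV[R]_n)
         (P : 'I_k -> seq R) (lambda kappa : R),
    (1 <= k)%N -> (1 <= d)%N -> (1 <= T <= n)%N ->
    0 < lambda -> 0 < kappa ->
    (forall f : 'I_k, uniq (P f) /\ (size (P f) <= T)%N) ->
    (cost (CLARITree X y P lambda kappa d))%:R <=
      C * (k%:R * n%:R * ln n%:R + d%:R ^+ 2 * n%:R * k%:R ^+ 4 * T%:R).
Proof.
(* 1053 is 1051 plus the 2 left by the [+ 1] of the rounded logarithm; the logarithmic term itself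
   only needs 4. *)
exists 1053; split=> [|n k T d X y P lambda kappa k0 d0 Tn _ _ HP].
  exact: ltr0n.
have c := cost_CLARITree X y lambda kappa k0 (fun f => proj2 (HP f)) d0 Tn.
have /andP[T0 Tn'] := Tn; have n0 : (0 < n)%N := leq_trans T0 Tn'.
have ln0 : 0 <= ln n%:R :> R by rewrite ln_ge0 // ler1n.
(* The remainder [k * n] must go into the second term, since [ln n] vanishes at [n = 1]. *)
have knW : (k * n <= d ^ 2 * n * k ^ 4 * T)%N.
  have -> : (d ^ 2 * n * k ^ 4 * T = k ^ 4 * n * (d ^ 2 * T))%N by lia.
  rewrite -[X in (X <= _)%N]muln1 leq_mul ?muln_gt0 ?T0 ?expn_gt0 ?d0 //.
  by rewrite leq_mul2r -[X in (X <= _ ^ _)%N]expn1 leq_pexp2l ?orbT.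
have {c} : (cost (CLARITree X y P lambda kappa d))%:R <=
    (2 * (k * n * up_log 2 n) + 1051 * (d ^ 2 * n * k ^ 4 * T))%:R :> R.
  by rewrite ler_nat.
move/le_trans; apply.
rewrite -!natrX -!natrM.
move: knW; rewrite -(ler_nat R) natrD !(natrM _ 2) !(natrM _ 1051).
rewrite (natrM _ _ (up_log _ _)).
move: (d ^ 2 * n * k ^ 4 * T)%N%:R (k * n)%N%:R (ler0n R (k * n)) => W q q0 qW.
have := ler_wpM2l q0 (up_log2_le_ln R n0); have := mulr_ge0 q0 ln0; lra.
Qed.
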